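(* Let $n$ be a positive integer, $x=e^{2\pi i/n}$, and let $|0_L^{XT}\rangle=|\psi_0\rangle|\psi_1\rangle$ and $|1_L^{XT}\rangle=|\psi_1\rangle|\psi_0\rangle$ be the $4n$-qubit logical states of the extended dual-rail encoding. Then the qubit permutation $\alpha=\beta\otimes\beta$, where $\beta=(1,n+1)_q(2,n+2)_q\cdots(n,2n)_q$ acts on $2n$ qubits, implements the logical bit flip: $$\alpha|0_L^{XT}\rangle=|1_L^{XT}\rangle,\qquad \alpha|1_L^{XT}\rangle=|0_L^{XT}\rangle,$$ and the qubit permutation $\gamma=I_{2^{2n}}\otimes (n,n-1,\dots,1)_q$, which cycles the $n$ qubits of the third row, satisfies $$\gamma|0_L^{XT}\rangle=|0_L^{XT}\rangle,\qquad \gamma|1_L^{XT}\rangle=x\,|1_L^{XT}\rangle .$$ In particular, for $n=8$ (32 physical qubits), both the bit-flip gate and the $T$ gate $\begin{pmatrix}1&0\\0&e^{\pi i/4}\end{pmatrix}$ are implemented on the logical basis by permutations of the qubits.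
   Context: For $1\le j\le n$, $|(j)_n\rangle=X_j|0\rangle^{\otimes n}$ is the $n$-qubit computational basis state with a $|1\rangle$ in position $j$ and $|0\rangle$ elsewhere. With $x=e^{2\pi i/n}$, define the $2n$-qubit states $$|\psi_0\rangle=\frac1{\sqrt n}\sum_{j=1}^n x^{j-1}|(j)_n\rangle\otimes|0\rangle^{\otimes n},\qquad |\psi_1\rangle=|0\rangle^{\otimes n}\otimes\frac1{\sqrt n}\sum_{j=1}^n x^{j-1}|(j)_n\rangle .$$ The $4n$ qubits are arranged into four consecutive rows of $n$ qubits: row $r$ consists of qubits $(r-1)n+1,\dots,rn$. The subscript $q$ means that a permutation in cycle notation acts on qubits (tensor factors): the state of the $j$th qubit is moved to the position to which the permutation sends $j$. Thus $(j,n+j)_q$ swaps qubits $j$ and $n+j$, and $(n,n-1,\dots,1)_q$ moves the $j$th qubit to position $j-1$ for $j=2,\dots,n$ and the first qubit to position $n$. In $\gamma$, $I_{2^{2n}}$ is the identity on the first two rows, the cyclic permutation acts on the third row, and the fourth row is left unchanged. *)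

(* Defs.v *)
From HB Require Import structures.
From mathcomp Require Import all_boot all_order all_algebra all_fingroup.
From mathcomp Require Import complex.
From mathcomp Require Import reals trigo.

Set Implicit Arguments.
Unset Strict Implicit.
Unset Printing Implicit Defensive.

Import GRing.Theory Num.Theory.
Local Open Scope ring_scope.
Local Open Scope complex_scope.

(* e^{i t} *)
Definition cis (R : realType) (t : R) : R[i] := cos t +i* sin t.

(* Qubits are numbered from 0: the qubit j of the mathematical text is the
   ordinal of value j - 1. *)
Definition bits (n : nat) := {ffun 'I_n -> bool}.

(* The state space (C^2)^{(x) n}: amplitudes over the computational basis.  The
   codomain is R[i]^o so that the space is a vectType over R[i]. *)
Notation qstate R n := {ffun bits n -> (R[i])^o}.

(* Linear operators from n qubits to n qubits. *)
Notation qop R n := 'End(qstate R n).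

Definition ket (R : realType) (n : nat) (b : bits n) : qstate R n :=
  [ffun c => (c == b)%:R].

Definition lbits (m n : nat) (b : bits (m + n)) : bits m :=
  [ffun i => b (lshift n i)].
Definition rbits (m n : nat) (b : bits (m + n)) : bits n :=
  [ffun i => b (rshift m i)].

Definition tens (R : realType) (m n : nat) (u : qstate R m) (v : qstate R n) :
    qstate R (m + n) :=
  [ffun b => (u (lbits b) : R[i]) * v (rbits b)].

Definition lin_ext (R : realType) (n : nat) (f : bits n -> qstate R n)
    (u : qstate R n) : qstate R n :=
  \sum_b (u b : R[i]) *: f b.

Lemma lin_ext_is_linear (R : realType) (n : nat) (f : bits n -> qstate R n) :
  linear (lin_ext f).
Proof.
move=> a u v; rewrite /lin_ext scaler_sumr -big_split /=.
by apply: eq_bigr => b _; rewrite !ffunE scalerDl scalerA.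
Qed.

HB.instance Definition _ (R : realType) (n : nat) (f : bits n -> qstate R n) :=
  GRing.isLinear.Build R[i] (qstate R n) (qstate R n) *:%R (lin_ext f)
    (@lin_ext_is_linear R n f).

(* The operator sending each basis state |b> to f b. *)
Definition qop_of_basis (R : realType) (n : nat) (f : bits n -> qstate R n) :
    qop R n :=
  linfun (lin_ext f).

Lemma qop_of_basisE (R : realType) (n : nat) (f : bits n -> qstate R n)
    (b : bits n) :
  qop_of_basis f (ket R b) = f b.
Proof.
rewrite lfunE /= /lin_ext (bigD1 b) //= ffunE eqxx scale1r big1 ?addr0 //.
by move=> c /negPf nbc; rewrite ffunE nbc scale0r.
Qed.

(* The qubit in position j is moved to position s j, so that the bit found in
   position i of the result is the one that was in position s^-1 i. *)
Definition qperm (R : realType) (n : nat) (s : 'S_n) : qop R n :=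
  qop_of_basis (fun b => ket R [ffun i => b ((s^-1)%g i)]).

Definition tensop (R : realType) (m n : nat) (A : qop R m) (B : qop R n) :
    qop R (m + n) :=
  qop_of_basis
    (fun b => tens (A (ket R (lbits b))) (B (ket R (rbits b)))).

Definition is_qubit_perm (R : realType) (n : nat) (U : qop R n) : Prop :=
  exists s : 'S_n, U = qperm R s.

Definition zeros (n : nat) : bits n := [ffun=> false].
Definition one_at (n : nat) (j : 'I_n) : bits n := [ffun i => i == j].

(* e^{2 pi i / n} *)
Definition omega (R : realType) (n : nat) : R[i] := cis (2 * pi / n%:R).

Definition wstate (R : realType) (n : nat) : qstate R n :=
  ((Num.sqrt (n%:R : R))^-1)%:C *:
    \sum_(j < n) omega R n ^+ j *: ket R (one_at j).

Definition psi0 (R : realType) (n : nat) : qstate R (n + n) :=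
  tens (wstate R n) (ket R (zeros n)).
Definition psi1 (R : realType) (n : nat) : qstate R (n + n) :=
  tens (ket R (zeros n)) (wstate R n).

Definition zeroL (R : realType) (n : nat) : qstate R ((n + n) + (n + n)) :=
  tens (psi0 R n) (psi1 R n).
Definition oneL (R : realType) (n : nat) : qstate R ((n + n) + (n + n)) :=
  tens (psi1 R n) (psi0 R n).

(* (1, n+1)(2, n+2)...(n, 2n) *)
Definition beta_perm (n : nat) : 'S_(n + n) :=
  (\prod_(j < n) tperm (lshift n j) (rshift n j))%g.

(* (n, n-1, ..., 1): j goes to j - 1 modulo n *)
Definition cycle_perm (n : nat) : 'S_n := perm (@ord_pred_inj n).

Definition beta (R : realType) (n : nat) : qop R (n + n) :=
  qperm R (beta_perm n).
Definition alpha (R : realType) (n : nat) : qop R ((n + n) + (n + n)) :=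
  tensop (beta R n) (beta R n).

Definition gamma (R : realType) (n : nat) : qop R ((n + n) + (n + n)) :=
  tensop \1%VF (tensop (qperm R (cycle_perm n)) \1%VF).

(* U acts on the pair (l0, l1) of logical basis states through the matrix G:
   column b of G holds the coordinates of U l_b. *)
Definition implements (R : realType) (N : nat) (l0 l1 : qstate R N)
    (U : qop R N) (G : 'M[R[i]]_2) : Prop :=
  U l0 = G 0 0 *: l0 + G 1 0 *: l1 /\
  U l1 = G 0 1 *: l0 + G 1 1 *: l1.

Definition gateX (R : realType) : 'M[R[i]]_2 :=
  \matrix_(a, b) (a != b)%:R.

(* diag(1, e^{i pi / 4}) *)
Definition gateT (R : realType) : 'M[R[i]]_2 :=
  \matrix_(a, b) if a == b then (if a == 0 then 1 else cis (pi / 4)) else 0.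

(* Main.v *)
Require Import Defs.
From mathcomp Require Import all_boot all_order all_algebra all_fingroup.
From mathcomp Require Import complex.
From mathcomp Require Import reals trigo.

(** A qubit permutation acts on amplitudes by reindexing bit strings, so a
    tensor product of qubit permutations is again one, and acts factorwise on
    product states.  Exchanging the two rows of a block exchanges psi0 and psi1,
    while the cyclic shift fixes the zero row and multiplies the discrete plane
    wave [wstate] by its quasi-momentum phase, because [omega ^+ n = 1]. *)

Set Implicit Arguments.
Unset Strict Implicit.
Unset Printing Implicit Defensive.

Import GRing.Theory Num.Theory.
Local Open Scope ring_scope.
Local Open Scope complex_scope.

Lemma qstate_ketE (R : realType) (n : nat) (u : qstate R n) :
  u = \sum_b (u b : R[i]) *: ket R b.
Proof.
apply/ffunP => c; rewrite sum_ffunE (bigD1 c) //= !ffunE eqxx.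
rewrite big1 => [|b /negPf nbc]; last by rewrite !ffunE eq_sym nbc scaler0.
by rewrite addr0 /GRing.scale /= mulr1.
Qed.

Lemma eq_qop (R : realType) (n : nat) (A B : qop R n) :
  (forall b, A (ket R b) = B (ket R b)) -> A = B.
Proof.
move=> eqAB; apply/lfunP => u; rewrite (qstate_ketE u) !linear_sum /=.
by apply: eq_bigr => b _; rewrite !linearZ /= eqAB.
Qed.

Lemma qperm_ket (R : realType) (n : nat) (s : 'S_n) (b : bits n) :
  qperm R s (ket R b) = ket R [ffun i => b ((s^-1)%g i)].
Proof. exact: qop_of_basisE. Qed.

(** The only basis string that the permutation carries to [c] is [c] precomposed with [s], so one
    term of the basis expansion survives. The inverse in [qperm] thus becomes [s] itself on
    amplitudes. *)
Lemma qpermE (R : realType) (n : nat) (s : 'S_n) (u : qstate R n)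
    (c : bits n) :
  qperm R s u c = u [ffun i => c (s i)].
Proof.
rewrite {1}(qstate_ketE u) linear_sum sum_ffunE /=.
rewrite (bigD1 [ffun i => c (s i)]) //= linearZ /= qperm_ket !ffunE.
have -> : [ffun i => [ffun i => c (s i)] ((s^-1)%g i)] = c.
  by apply/ffunP => i; rewrite !ffunE permKV.
rewrite eqxx big1 => [|b /negPf nbc].
  by rewrite addr0 /GRing.scale /= mulr1.
rewrite linearZ /= qperm_ket !ffunE; case: eqP => [cE|_]; last first.
  by rewrite scaler0.
move/negP: nbc; case; apply/eqP/ffunP => i.
by rewrite cE !ffunE permK.
Qed.

Lemma qperm1 (R : realType) (n : nat) : qperm R (1%g : 'S_n) = \1%VF.
Proof.
apply/lfunP => u; apply/ffunP => c; rewrite qpermE id_lfunE.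
by congr (u _); apply/ffunP => i; rewrite ffunE perm1.
Qed.

Lemma ket_tens (R : realType) (m n : nat) (b : bits (m + n)) :
  ket R b = tens (ket R (lbits b)) (ket R (rbits b)).
Proof.
apply/ffunP => c; rewrite !ffunE -natrM mulnb; congr (nat_of_bool _)%:R.
apply/eqP/andP => [-> //|[/eqP/ffunP lE /eqP/ffunP rE]].
apply/ffunP => i; rewrite -(splitK i).
case: (split i) => j /=; first by have := lE j; rewrite !ffunE.
by have := rE j; rewrite !ffunE.
Qed.

Definition sum_perm_fun (m n : nat) (s : 'S_m) (t : 'S_n) (i : 'I_(m + n)) :
    'I_(m + n) :=
  match split i with inl j => lshift n (s j) | inr j => rshift m (t j) end.

Lemma sum_perm_fun_inj (m n : nat) (s : 'S_m) (t : 'S_n) :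
  injective (sum_perm_fun s t).
Proof.
apply: (can_inj (g := sum_perm_fun s^-1 t^-1)) => i; rewrite -{2}(splitK i).
rewrite /sum_perm_fun; case: (split i) => j /=.
  by rewrite (unsplitK (inl (s j))) permK.
by rewrite (unsplitK (inr (t j))) permK.
Qed.

Definition sum_perm (m n : nat) (s : 'S_m) (t : 'S_n) : 'S_(m + n) :=
  perm (@sum_perm_fun_inj m n s t).

Lemma sum_perm_lshift (m n : nat) (s : 'S_m) (t : 'S_n) (j : 'I_m) :
  sum_perm s t (lshift n j) = lshift n (s j).
Proof. by rewrite permE /sum_perm_fun (unsplitK (inl j)). Qed.

Lemma sum_perm_rshift (m n : nat) (s : 'S_m) (t : 'S_n) (j : 'I_n) :
  sum_perm s t (rshift m j) = rshift m (t j).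
Proof. by rewrite permE /sum_perm_fun (unsplitK (inr j)). Qed.

Lemma qperm_tens (R : realType) (m n : nat) (s : 'S_m) (t : 'S_n)
    (u : qstate R m) (v : qstate R n) :
  qperm R (sum_perm s t) (tens u v) = tens (qperm R s u) (qperm R t v).
Proof.
apply/ffunP => c; rewrite qpermE !ffunE !qpermE.
by congr ((u _ : R[i]) * v _); apply/ffunP => i;
  rewrite !ffunE ?sum_perm_lshift ?sum_perm_rshift.
Qed.

(** Operators are determined by their values on kets, and each ket is a product ket, where both
    sides act factorwise. This is what makes [alpha] and [gamma] genuine qubit permutations. *)
Lemma tensop_qperm (R : realType) (m n : nat) (s : 'S_m) (t : 'S_n) :
  tensop (qperm R s) (qperm R t) = qperm R (sum_perm s t).
Proof.
by apply: eq_qop => b; rewrite qop_of_basisE [in RHS]ket_tens qperm_tens.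
Qed.

(** The product is taken over an arbitrary duplicate-free list so that induction applies; both rows
    are tracked at once because each swap exchanges them. *)
Lemma prod_tperm_shift (n : nat) (r : seq 'I_n) (i : 'I_n) :
  uniq r ->
  let p := (\prod_(j <- r) tperm (lshift n j) (rshift n j))%g in
  p (lshift n i) = (if i \in r then rshift n i else lshift n i) /\
  p (rshift n i) = (if i \in r then lshift n i else rshift n i).
Proof.
elim: r => [|j r IHr] /=; first by rewrite big_nil !perm1.
case/andP=> jr /IHr[IHl IHrr]; rewrite big_cons !permM in_cons.
(* The head transposition acts first. If it moves [i], then [i] is absent from the tail, which fixes
   both of its positions; otherwise it leaves them alone. *)
have [eq_ij /=|ne_ij /=] := eqVneq i j.
  by rewrite -eq_ij tpermL tpermR IHl IHrr eq_ij (negPf jr).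
by rewrite !tpermD ?eq_lrshift ?eq_rlshift ?eq_lshift ?eq_rshift // eq_sym.
Qed.

Lemma beta_perm_lshift (n : nat) (j : 'I_n) :
  beta_perm n (lshift n j) = rshift n j.
Proof.
by have [-> _] := prod_tperm_shift j (index_enum_uniq 'I_n);
  rewrite mem_index_enum.
Qed.

Lemma beta_perm_rshift (n : nat) (j : 'I_n) :
  beta_perm n (rshift n j) = lshift n j.
Proof.
by have [_ ->] := prod_tperm_shift j (index_enum_uniq 'I_n);
  rewrite mem_index_enum.
Qed.

Lemma beta_tens (R : realType) (n : nat) (u v : qstate R n) :
  beta R n (tens u v) = tens v u.
Proof.
apply/ffunP => c; rewrite qpermE !ffunE mulrC.
by congr ((v _ : R[i]) * u _); apply/ffunP => i;
  rewrite !ffunE ?beta_perm_lshift ?beta_perm_rshift.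
Qed.

Lemma alphaE (R : realType) (n : nat) :
  alpha R n = qperm R (sum_perm (beta_perm n) (beta_perm n)).
Proof. exact: tensop_qperm. Qed.

Lemma alpha_tens (R : realType) (n : nat) (u v : qstate R (n + n)) :
  alpha R n (tens u v) = tens (beta R n u) (beta R n v).
Proof. by rewrite alphaE qperm_tens. Qed.

(** Each identity factor is a qubit permutation, that of the trivial permutation, so the nested
    tensor product collapses to a block sum. *)
Lemma gammaE (R : realType) (n : nat) :
  gamma R n = qperm R (sum_perm 1%g (sum_perm (cycle_perm n) 1%g)).
Proof. by rewrite /gamma -!qperm1 !tensop_qperm. Qed.

Lemma gamma_tens (R : realType) (n : nat) (u : qstate R (n + n))
    (v w : qstate R n) :
  gamma R n (tens u (tens v w)) =
    tens u (tens (qperm R (cycle_perm n) v) w).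
Proof. by rewrite gammaE !qperm_tens !qperm1 !id_lfunE. Qed.

Lemma tensZl (R : realType) (m n : nat) (a : R[i]) (u : qstate R m)
    (v : qstate R n) :
  tens (a *: u) v = a *: tens u v.
Proof. by apply/ffunP => c; rewrite !ffunE /GRing.scale /= mulrA. Qed.

Lemma tensZr (R : realType) (m n : nat) (a : R[i]) (u : qstate R m)
    (v : qstate R n) :
  tens u (a *: v) = a *: tens u v.
Proof. by apply/ffunP => c; rewrite !ffunE /GRing.scale /= mulrCA. Qed.

Lemma qperm_zeros (R : realType) (n : nat) (s : 'S_n) :
  qperm R s (ket R (zeros n)) = ket R (zeros n).
Proof.
by rewrite qperm_ket; congr ket; apply/ffunP => i; rewrite !ffunE.
Qed.

Lemma qperm_one_at (R : realType) (n : nat) (s : 'S_n) (j : 'I_n) :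
  qperm R s (ket R (one_at j)) = ket R (one_at (s j)).
Proof.
rewrite qperm_ket; congr ket; apply/ffunP => i.
by rewrite !ffunE (canF_eq (permKV s)).
Qed.

Lemma cisD (R : realType) (s t : R) : cis (s + t) = cis s * cis t.
Proof.
by rewrite /cis cosD sinD; apply/eqP; rewrite eq_complex /= eqxx addrC eqxx.
Qed.

Lemma cis0 (R : realType) : cis (0 : R) = 1.
Proof. by rewrite /cis cos0 sin0. Qed.

Lemma cis_mulrn (R : realType) (t : R) (k : nat) : cis (t *+ k) = cis t ^+ k.
Proof.
by elim: k => [|k IHk]; rewrite ?mulr0n ?cis0 // mulrS cisD IHk exprS.
Qed.

Lemma omegaXn (R : realType) (n : nat) : (0 < n)%N -> omega R n ^+ n = 1.
Proof.
(* The power is [cis] of [n] copies of the angle, which add up to a full turn. *)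
move=> n_gt0; rewrite -cis_mulrn -[(_ / _) *+ n]mulr_natr.
rewrite divfK ?pnatr_eq0 -?lt0n //.
by rewrite /cis mulr_natl cos2pi sin2pi.
Qed.

Lemma cycle_wstate (R : realType) (n : nat) :
  (0 < n)%N ->
  qperm R (cycle_perm n) (wstate R n) = omega R n *: wstate R n.
Proof.
move=> n_gt0; rewrite /wstate linearZ /= scalerA mulrC -scalerA.
congr (_ *: _); rewrite linear_sum /= scaler_sumr.
(* Reindexing by the cyclic successor undoes the shift on kets and moves it to the exponents. *)
rewrite (reindex_inj (@ordS_inj n)) /=; apply: eq_bigr => j _.
rewrite linearZ /= qperm_one_at permE ordSK scalerA -exprS.
(* The exponent is [j.+1] modulo [n]; the wraparound at the last qubit costs nothing since
   [omega ^+ n = 1]. *)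
by rewrite expr_mod // omegaXn.
Qed.

Lemma omega8 (R : realType) : omega R 8 = cis (pi / 4).
Proof.
congr cis; rewrite (natrM _ 2 4) invfM mulrACA divff ?mul1r //.
by rewrite pnatr_eq0.
Qed.

Lemma alpha_zeroL (R : realType) (n : nat) : alpha R n (zeroL R n) = oneL R n.
Proof. by rewrite alpha_tens !beta_tens. Qed.

Lemma alpha_oneL (R : realType) (n : nat) : alpha R n (oneL R n) = zeroL R n.
Proof. by rewrite alpha_tens !beta_tens. Qed.

(** The third row is the first half of [psi1], hence all zeros. *)
Lemma gamma_zeroL (R : realType) (n : nat) : gamma R n (zeroL R n) = zeroL R n.
Proof. by rewrite gamma_tens qperm_zeros. Qed.

(** Here the third row carries [wstate], an eigenvector of the shift; its phase factors out of the
    product by bilinearity. *)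
Lemma gamma_oneL (R : realType) (n : nat) :
  (0 < n)%N -> gamma R n (oneL R n) = omega R n *: oneL R n.
Proof. by move=> n_gt0; rewrite gamma_tens cycle_wstate // tensZl tensZr. Qed.

Lemma alpha_is_qubit_perm (R : realType) (n : nat) : is_qubit_perm (alpha R n).
Proof. by eexists; exact: alphaE. Qed.

Lemma gamma_is_qubit_perm (R : realType) (n : nat) : is_qubit_perm (gamma R n).
Proof. by eexists; exact: gammaE. Qed.

Theorem mainTheorem2 (R : realType) :
  (forall n : nat, (0 < n)%N ->
     [/\ is_qubit_perm (alpha R n),
         alpha R n (zeroL R n) = oneL R n &
         alpha R n (oneL R n) = zeroL R n] /\
     [/\ is_qubit_perm (gamma R n),
         gamma R n (zeroL R n) = zeroL R n &
         gamma R n (oneL R n) = omega R n *: oneL R n]) /\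
  (@is_qubit_perm R 32 (alpha R 8) /\
   implements (zeroL R 8) (oneL R 8) (alpha R 8) (gateX R)) /\
  (@is_qubit_perm R 32 (gamma R 8) /\
   implements (zeroL R 8) (oneL R 8) (gamma R 8) (gateT R)).
Proof.
split=> [n n_gt0|].
  split; split; first exact: alpha_is_qubit_perm.
  - exact: alpha_zeroL.
  - exact: alpha_oneL.
  - exact: gamma_is_qubit_perm.
  - exact: gamma_zeroL.
  - exact: gamma_oneL.
(* The count [(8 + 8) + (8 + 8)] computes to 32, so the general fact applies by conversion. *)
split; split; first exact: (alpha_is_qubit_perm R 8).
- rewrite /implements alpha_zeroL alpha_oneL.
  by split; rewrite !mxE /= scale0r scale1r ?add0r ?addr0.
- exact: (gamma_is_qubit_perm R 8).
- rewrite /implements gamma_zeroL gamma_oneL // omega8.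
  by split; rewrite !mxE /= scale0r ?scale1r ?add0r ?addr0.
Qed.
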